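(* Let $d\ge 1$, let $g_r, g_f \in \mathbb{R}^d$, and let $Q>0$, $R>0$ satisfy $Q \le R\|g_f\|$. Put $\kappa := g_r\cdot g_f$, $\; g_{r,\perp} := g_r - \frac{g_r\cdot g_f}{\|g_f\|^2}\, g_f$ (the component of $g_r$ orthogonal to $g_f$), and $\kappa_1 := -\frac{Q\|g_r\|}{R}$. Then the optimal value $$F_r^* := \min\{\, g_r\cdot \Delta w \;:\; \Delta w\in\mathbb{R}^d,\ g_f\cdot \Delta w \ge Q,\ \|\Delta w\|\le R \,\}$$ is given by $$F_r^* = \begin{cases} -R\|g_r\| & \text{if } \kappa\le \kappa_1,\\[4pt] \dfrac{\kappa Q}{\|g_f\|^2} - \|g_{r,\perp}\|\sqrt{R^2-\dfrac{Q^2}{\|g_f\|^2}} & \text{otherwise.}\end{cases}$$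
   Context: $\cdot$ is the Euclidean inner product and $\|\cdot\|$ the Euclidean norm on $\mathbb{R}^d$. In the application, $g_r$ and $g_f$ are the gradients at the current model weights of the average loss on the retain data and on the forget data respectively, $\Delta w$ is the weight update, and $F_r^*$ is called the minimum cost of forgetting; the statement uses $g_r,g_f$ only as vectors in $\mathbb{R}^d$. Note that $Q>0$ and $Q\le R\|g_f\|$ imply $g_f\neq 0$. *)

(* Defs.v *)
From mathcomp Require Import all_boot all_order all_algebra.
From mathcomp Require Import all_classical all_reals.

Set Implicit Arguments.
Unset Strict Implicit.
Unset Printing Implicit Defensive.

Import Order.TTheory GRing.Theory Num.Theory.
Local Open Scope classical_set_scope.
Local Open Scope ring_scope.

Definition dotv (K : realType) (d : nat) (u v : 'rV[K]_d) : K :=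
  \sum_(i < d) u 0 i * v 0 i.

(* The norm that MathComp-Analysis puts on 'rV[K]_d is the sup norm. *)
Definition enorm (K : realType) (d : nat) (u : 'rV[K]_d) : K :=
  Num.sqrt (dotv u u).

(* m = min A; in particular the minimum is attained. *)
Definition is_min (K : realType) (A : set K) (m : K) : Prop :=
  A m /\ lbound A m.

(* Main.v *)
Require Import Defs.
From mathcomp Require Import all_boot all_order all_algebra.
From mathcomp Require Import all_classical all_reals.
From mathcomp Require Import ring lra.

(** Lower bounds: if the half-space constraint is inactive this is
    Cauchy-Schwarz. Otherwise split [dw] along [gf] and its orthogonal
    complement, with scalar coordinates [x >= q := Q / |gf|] and [y >= 0], where
    [x^2 + y^2 <= R^2]; the problem becomes the planar one of minimizing
    [k x - P y], where [k := kappa / |gf|] and [P := |gr_perp|], and the case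
    hypothesis says that the minimizer on the disc lies at [x <= q], which moves
    the constrained minimizer to the corner [(q, sqrt (R^2 - q^2))]. *)

Set Implicit Arguments.
Unset Strict Implicit.
Unset Printing Implicit Defensive.

Import Order.TTheory GRing.Theory Num.Theory.
Local Open Scope classical_set_scope.
Local Open Scope ring_scope.

Section EuclideanSpace.
Context {K : realType} {d : nat}.
Implicit Types (u v w : 'rV[K]_d) (a : K).

Lemma dotvC u v : dotv u v = dotv v u.
Proof. by apply: eq_bigr => i _; rewrite mulrC. Qed.

Lemma dotvDl u v w : dotv (u + v) w = dotv u w + dotv v w.
Proof. by rewrite -big_split; apply: eq_bigr => i _; rewrite mxE mulrDl. Qed.

Lemma dotvZl a u v : dotv (a *: u) v = a * dotv u v.
Proof. by rewrite mulr_sumr; apply: eq_bigr => i _; rewrite mxE mulrA. Qed.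

Lemma dotvNl u v : dotv (- u) v = - dotv u v.
Proof. by rewrite -scaleN1r dotvZl mulN1r. Qed.

Lemma dotvDr u v w : dotv w (u + v) = dotv w u + dotv w v.
Proof. by rewrite !(dotvC w) dotvDl. Qed.

Lemma dotvZr a u v : dotv u (a *: v) = a * dotv u v.
Proof. by rewrite !(dotvC u) dotvZl. Qed.

Lemma dotvNr u v : dotv u (- v) = - dotv u v.
Proof. by rewrite !(dotvC u) dotvNl. Qed.

Definition dotvE := (dotvDl, dotvDr, dotvNl, dotvNr, dotvZl, dotvZr).

Lemma dotv_ge0 u : 0 <= dotv u u.
Proof. by apply: sumr_ge0 => i _; rewrite -expr2 sqr_ge0. Qed.

Lemma dotv_eq0 u : (dotv u u == 0) = (u == 0).
Proof.
apply/eqP/eqP => [/psumr_eq0P u0|->]; last by rewrite -(scale0r 0) dotvZl mul0r.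
apply/rowP => i; rewrite mxE; apply/eqP; rewrite -sqrf_eq0 expr2.
by rewrite u0// => j _; rewrite -expr2 sqr_ge0.
Qed.

Lemma enorm_ge0 u : 0 <= enorm u.
Proof. exact: sqrtr_ge0. Qed.

Lemma sqr_enorm u : enorm u ^+ 2 = dotv u u.
Proof. by rewrite sqr_sqrtr// dotv_ge0. Qed.

Lemma enorm_eq0 u : (enorm u == 0) = (u == 0).
Proof. by rewrite -sqrf_eq0 sqr_enorm dotv_eq0. Qed.

Lemma enorm_le u a : 0 <= a -> (enorm u <= a) = (dotv u u <= a ^+ 2).
Proof. by move=> a0; rewrite -sqr_enorm ler_pXn2r// nnegrE enorm_ge0. Qed.

(** Cauchy-Schwarz: for nonzero vectors, the squared norm of [|v| u - |u| v] expands to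
    [2 |u| |v| (|u| |v| - u.v)], and the positive factor cancels. *)
Lemma dotv_enorm_le u v : dotv u v <= enorm u * enorm v.
Proof.
have [->|u0] := eqVneq u 0.
  by rewrite -(scale0r 0) dotvZl mul0r mulr_ge0// enorm_ge0.
have [->|v0] := eqVneq v 0.
  by rewrite -(scale0r 0) dotvZr mul0r mulr_ge0// enorm_ge0.
have up : 0 < enorm u by rewrite lt_def enorm_ge0 enorm_eq0 u0.
have vp : 0 < enorm v by rewrite lt_def enorm_ge0 enorm_eq0 v0.
have := dotv_ge0 (enorm v *: u - enorm u *: v).
rewrite !dotvE -!sqr_enorm (dotvC v u) => h.
rewrite -subr_ge0 -(pmulr_rge0 _ (mulr_gt0 up vp)) -(pmulr_rge0 _ (ltr0n K 2)).
by apply: le_trans h _; rewrite le_eqVlt; apply/orP; left; apply/eqP; ring.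
Qed.

Lemma dotv_enorm_ge u v : - (enorm u * enorm v) <= dotv u v.
Proof.
rewrite lerNl -dotvNl; apply: le_trans (dotv_enorm_le _ _) _.
by rewrite /enorm !dotvE opprK.
Qed.

End EuclideanSpace.

(** For [k < 0] the last hypothesis is the squared form of [- k R / sqrt (k^2 + P^2) <= q], whose
    left side is the abscissa of the minimizer on the disc. Then [- k q (x - q) <= - k s (s - y) <=
    q P (s - y)], and dividing by [q] concludes. For [0 <= k] both terms are monotone. *)
Lemma planar_corner_min {K : realFieldType} (k P q s R x y : K) :
    0 < q -> 0 <= s -> 0 <= P -> 0 <= y -> q ^+ 2 + s ^+ 2 = R ^+ 2 ->
    x ^+ 2 + y ^+ 2 <= R ^+ 2 -> q <= x ->
    0 <= k \/ (R * k) ^+ 2 <= q ^+ 2 * (k ^+ 2 + P ^+ 2) ->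
  k * q - P * s <= k * x - P * y.
Proof.
move=> q0 s0 P0 y0 qsR xyR qx hk.
have ys : y <= s by rewrite -(@ler_pXn2r _ 2)//; nra.
have Pys : 0 <= P * (s - y) by rewrite mulr_ge0// subr_ge0.
have [k0|k0] := leP 0 k.
  have : 0 <= k * (x - q) by rewrite mulr_ge0// subr_ge0.
  by move: Pys; rewrite !mulrBr; lra.
case: hk => [|hk]; first by rewrite leNgt k0.
(* Substituting [R^2 = q^2 + s^2] in the hypothesis cancels [q^2 k^2] and leaves
   [(k s)^2 <= (q P)^2]. *)
have ksP : - k * s <= q * P.
  by rewrite -(@ler_pXn2r _ 2) ?nnegrE ?mulr_ge0 ?oppr_ge0 ?(ltW k0) ?(ltW q0)//;
     move: hk; rewrite !exprMn -qsR; lra.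
(* [(q, s)] is an outer normal of the disc at the corner. *)
have tangent : q * (x - q) <= s * (s - y).
  by have := sqr_ge0 (x - q); have := sqr_ge0 (y - s); nra.
have h1 : - k * (q * (x - q)) <= - k * (s * (s - y)).
  by rewrite ler_wpM2l// oppr_ge0 ltW.
have h2 : - k * s * (s - y) <= q * P * (s - y).
  by rewrite ler_wpM2r// subr_ge0.
rewrite -subr_ge0 -(pmulr_rge0 _ q0); lra.
Qed.

Theorem theorem4p1 (K : realType) (d : nat) (hd : (1 <= d)%N)
    (gr gf : 'rV[K]_d) (Q R : K) (hQ : 0 < Q) (hR : 0 < R)
    (hQR : Q <= R * enorm gf) :
  let kappa := dotv gr gf in
  let gr_perp := gr - (dotv gr gf / enorm gf ^+ 2) *: gf in
  let kappa1 := - (Q * enorm gr / R) in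
  is_min
    [set dotv gr dw | dw in [set dw : 'rV[K]_d | Q <= dotv gf dw /\ enorm dw <= R]]
    (if kappa <= kappa1 then - (R * enorm gr)
     else kappa * Q / enorm gf ^+ 2
          - enorm gr_perp * Num.sqrt (R ^+ 2 - Q ^+ 2 / enorm gf ^+ 2)).
Proof.
move=> kappa gp kappa1.
set n := enorm gf; set s := Num.sqrt _.
have n0 : 0 < n by rewrite -(pmulr_rgt0 _ hR); exact: lt_le_trans hQR.
have nE : dotv gf gf = n ^+ 2 by rewrite sqr_enorm.
have n_neq0 : n != 0 by rewrite gt_eqF.
have R_neq0 : R != 0 by rewrite gt_eqF.
have [hk|hk] := leP kappa kappa1.
  split=> [|_ [dw [_ dwR] <-]]; last first.
    apply: le_trans (dotv_enorm_ge _ _).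
    by rewrite lerN2 mulrC ler_wpM2r// enorm_ge0.
  have [gr0|gr0] := eqVneq gr 0.
    (* The objective vanishes identically, so any feasible point will do. *)
    exists ((R / n) *: gf).
      split; first by rewrite dotvZr nE expr2 mulrA mulfVK.
      rewrite enorm_le ?(ltW hR)// !dotvE nE le_eqVlt; apply/orP; left.
      by apply/eqP; field.
    have /eqP -> : enorm gr == 0 by rewrite enorm_eq0 gr0.
    by rewrite mulr0 oppr0 gr0 -(scale0r 0) dotvZl mul0r.
  have m_neq0 : enorm gr != 0 by rewrite enorm_eq0.
  have m0 : 0 < enorm gr by rewrite lt_def enorm_ge0 m_neq0.
  (* The equality case of Cauchy-Schwarz on the sphere of radius [R]; [kappa <= kappa1] says exactly
     that it satisfies the half-space constraint. *)
  exists (- (R / enorm gr) *: gr); last by rewrite dotvZr -sqr_enorm; field.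
  split.
    rewrite dotvZr dotvC -/kappa mulNr -mulrN mulrAC ler_pdivlMr//.
    by move: hk; rewrite lerNr ler_pdivrMr// mulrC [_ * R]mulrC.
  rewrite enorm_le ?(ltW hR)// !dotvE -sqr_enorm le_eqVlt; apply/orP; left.
  by apply/eqP; field.
have s0 : 0 <= s by exact: sqrtr_ge0.
have s2 : s ^+ 2 = R ^+ 2 - Q ^+ 2 / n ^+ 2.
  rewrite sqr_sqrtr// subr_ge0 ler_pdivrMr ?exprn_gt0// -exprMn.
  by rewrite ler_pXn2r// nnegrE ltW// mulr_gt0.
have gp_gf : dotv gp gf = 0.
  by rewrite !dotvE -/kappa -/n nE mulfVK ?sqrf_eq0 ?subrr.
have grE : gr = gp + (kappa / n ^+ 2) *: gf by rewrite subrK.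
clearbody gp.
have grgp : dotv gr gp = enorm gp ^+ 2.
  by rewrite {1}grE dotvDl dotvZl (dotvC gf) gp_gf mulr0 addr0 sqr_enorm.
split=> [|_ [dw [dwQ dwR] <-]].
  (* If [gp = 0], the junk value [s / 0 = 0] makes the second term vanish. *)
  exists ((Q / n ^+ 2) *: gf - (s / enorm gp) *: gp).
    split.
      rewrite !dotvE nE (dotvC gf) gp_gf mulr0 subr0.
      by rewrite mulfVK// sqrf_eq0.
    rewrite enorm_le ?(ltW hR)// !dotvE nE (dotvC gf) gp_gf -sqr_enorm.
    have [->|p0] := eqVneq (enorm gp) 0.
      rewrite invr0 !(mulr0, mul0r, oppr0, addr0).
      (* Here the witness is only [(Q / n^2) gf], and [0 <= s^2] bounds its squared norm [Q^2 / n^2]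
         by [R^2]. *)
      have := sqr_ge0 s; rewrite s2 subr_ge0; apply: le_trans.
      by rewrite le_eqVlt; apply/orP; left; apply/eqP; field.
    rewrite -[leRHS](subrK (Q ^+ 2 / n ^+ 2)) -s2.
    by rewrite le_eqVlt; apply/orP; left; apply/eqP; field; rewrite n_neq0.
  rewrite !dotvE grgp -/kappa; congr (_ - _); first by rewrite mulrC mulrA.
  have [->|p0] := eqVneq (enorm gp) 0; first by rewrite expr0n mulr0 mul0r.
  by field.
(* The planar coordinates of [dw] are [x = t / n] and [y = |w|]. *)
pose t := dotv gf dw.
pose w := dw - (t / n ^+ 2) *: gf.
have gf_w : dotv gf w = 0.
  by rewrite !dotvE nE mulfVK ?subrr// sqrf_eq0.
have dwE : dw = w + (t / n ^+ 2) *: gf by rewrite subrK.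
clearbody w.
have dwn : (t / n) ^+ 2 + enorm w ^+ 2 <= R ^+ 2.
  move: dwR; rewrite enorm_le ?(ltW hR)// [in dotv dw dw]dwE !dotvE.
  rewrite (dotvC w) gf_w nE -sqr_enorm; apply: le_trans.
  by rewrite le_eqVlt; apply/orP; left; apply/eqP; field.
have grn : enorm gr ^+ 2 = (kappa / n) ^+ 2 + enorm gp ^+ 2.
  rewrite sqr_enorm {1 2}grE !dotvE (dotvC gf gp) gp_gf nE -sqr_enorm.
  by field.
have -> : dotv gr dw = kappa / n * (t / n) + dotv gp w.
  rewrite grE dwE !dotvE gf_w gp_gf nE; field.
  exact: n_neq0.
(* Cauchy-Schwarz in the orthogonal complement of [gf] leaves the planar problem. *)
apply: (@le_trans _ _ (kappa / n * (t / n) - enorm gp * enorm w)); last first.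
  by rewrite lerD2l dotv_enorm_ge.
have -> : kappa * Q / n ^+ 2 = kappa / n * (Q / n) by field.
apply: (@planar_corner_min _ _ _ _ _ R); rewrite ?enorm_ge0 ?divr_gt0//.
- by rewrite s2 expr_div_n addrC subrK.
- by rewrite ler_pM2r// invr_gt0.
have [k0|k0] := leP 0 kappa; first by left; rewrite divr_ge0// ltW.
(* Since [k^2 + P^2 = |gr|^2], both sides are squares; as [kappa < 0], taking roots leaves
   [- kappa R <= Q |gr|], which follows from [kappa1 < kappa]. *)
right; rewrite -grn -exprMn -[leLHS]sqrrN -mulrN -mulNr.
have in0 : 0 <= n^-1 by rewrite invr_ge0 ltW.
have [Q0 R0 Nk0] : [/\ 0 <= Q, 0 <= R & 0 <= - kappa].
  by rewrite !ltW// oppr_gt0.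
rewrite ler_pXn2r ?nnegrE ?mulr_ge0 ?enorm_ge0//.
rewrite mulrA [leRHS]mulrAC ler_pM2r ?invr_gt0//.
by move: (ltW hk); rewrite lerNl ler_pdivlMr// mulrC.
Qed.
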